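(* Let $q$ be a prime power. Every Tallini curve $\mathcal X$ (over $\mathbb F_q$) is projectively equivalent, over the field $\mathbb F_{q^{3(q^2+q+1)}}$, to the Pellikaan curve $$\mathcal X_q:\quad X_1^{q+1}X_2+X_2^{q+1}X_0+X_0^{q+1}X_1=0 .$$
   Context: A Tallini curve over $\mathbb F_q$ is a plane irreducible curve of degree $q+2$ defined over $\mathbb F_q$ and containing all $q^2+q+1$ points of the projective plane $PG(2,q)$. By Tallini's classification, up to a projective transformation in $PGL(3,q)$ such a curve is exactly one with a homogeneous equation of the form $$(aX_0+bX_1+cX_2)\varphi_{01}-X_0\varphi_{02}+X_2\varphi_{12}=0,\qquad \varphi_{ij}=X_i^qX_j-X_iX_j^q,$$ where $a,b,c\in\mathbb F_q$ are such that the cubic polynomial $X^3-cX^2-aX-b$ is irreducible over $\mathbb F_q$. Two plane curves are projectively equivalent over a field $F$ if some element of $PGL(3,F)$ maps one onto the other. *)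

(* Defs.v *)
From HB Require Import structures.
From mathcomp Require Import all_boot all_order all_algebra.
From mathcomp Require Export mpoly.

Set Implicit Arguments.
Unset Strict Implicit.
Unset Printing Implicit Defensive.

Import GRing.Theory.
Local Open Scope ring_scope.

(* A plane curve is given by a form in X_0, X_1, X_2, which it determines up
   to a nonzero constant. *)

(* The units of {mpoly F[n]} are the nonzero constants. *)
Definition irreducible_mpoly (n : nat) (F : fieldType) (f : {mpoly F[n]}) :
    Prop :=
  f \isn't a GRing.unit /\
  (forall g h : {mpoly F[n]},
     f = g * h -> g \is a GRing.unit \/ h \is a GRing.unit).

(* A point of PG(2, F) is represented by any of its nonzero coordinate
   vectors. *)
Definition contains_all_points (F : fieldType) (f : {mpoly F[3]}) : Prop :=
  forall v : 'rV[F]_3, v != 0 -> f.@[fun i => v 0 i] = 0.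

(* Irreducibility is over F itself, which is implied by irreducibility over
   the algebraic closure. *)
Definition tallini_curve (F : finFieldType) (f : {mpoly F[3]}) : Prop :=
  [/\ f \is (#|F| + 2).-homog, irreducible_mpoly f & contains_all_points f].

(* The form f(A X), where X is the column vector of the variables. *)
Definition linear_subst (n : nat) (F : fieldType) (A : 'M[F]_n)
    (f : {mpoly F[n]}) : {mpoly F[n]} :=
  f \mPo [tuple \sum_(j < n) A i j *: 'X_j | i < n].

(* The projectivity [x] |-> [A x] maps the curve f = 0 onto the curve g = 0
   exactly when g(A X) = c f(X) with c nonzero. *)
Definition proj_equiv (F : fieldType) (f g : {mpoly F[3]}) : Prop :=
  exists (A : 'M[F]_3) (c : F),
    [/\ A \in unitmx, c != 0 & linear_subst A g = c *: f].

Definition pellikaan_form (F : fieldType) (q : nat) : {mpoly F[3]} :=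
  let X0 : {mpoly F[3]} := 'X_(@Ordinal 3 0 isT) in
  let X1 : {mpoly F[3]} := 'X_(@Ordinal 3 1 isT) in
  let X2 : {mpoly F[3]} := 'X_(@Ordinal 3 2 isT) in
  X1 ^+ (q + 1) * X2 + X2 ^+ (q + 1) * X0 + X0 ^+ (q + 1) * X1.

(* Main.v *)
Require Import Defs.
From mathcomp Require Import all_boot all_order all_algebra.
From mathcomp Require Import all_fingroup all_field.
From mathcomp Require Import ring zify.

(** Let f be an F-form of degree q + 2 vanishing at every point of PG(2, q).
    The forms vanishing there are generated by the minors
    X_i X_j^q - X_j X_i^q, so f = det (M X, X, X^q) for a square matrix M over
    F, where X is the column of the variables and X^q that of their q-th
    powers ([vanish_det_form]).  This coordinate-free version of Tallini's
    normal form replaces his classification: multiplying the three columns by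
    an invertible matrix only rescales the determinant.

    If M had a left eigenvector u over F, then the linear form u X would divide
    the three entries u M X, u X and u X^q = (u X)^q of a row combination of
    the determinant, hence f itself, against irreducibility
    ([det_form_eigenvalue]).  So the characteristic polynomial of M is an
    irreducible cubic.  It splits in the field K with q^(3 (q^2 + q + 1))
    elements, with roots x, x^q, x^(q^2), and M has left eigenvectors u, u^(q),
    u^(q^2) there, u having entries fixed by the q^3-power map
    ([cubic_eigenbasis]).  Let U be the matrix with these rows
    and Y = U X.  The columns of the determinant become D Y with D diagonal,
    Y, and the cyclic shift of Y^q, so that \det U * f is a combination of the
    three monomials of the Pellikaan form in the Y_i ([det_form_cyclic]).  The
    coefficients are the conjugates of a = x - x^q.

    It remains to rescale the Y_i.  Making the three coefficients equal takes a
    root of order n = q^2 + q + 1 of an element of the field with q^3 elements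
    ([equalizing_scalars]).  All such roots lie in the extension of degree n,
    because n divides q^3 - 1 ([subfield_nth_root]); this is why K is large
    enough. *)

Set Implicit Arguments.
Unset Strict Implicit.
Unset Printing Implicit Defensive.

Import GRing.Theory.
Local Open Scope ring_scope.

Local Notation i0 := (@Ordinal 3 0 isT).
Local Notation i1 := (@Ordinal 3 1 isT).
Local Notation i2 := (@Ordinal 3 2 isT).

(** * Determinants of three columns *)

Definition col3_mx (R : comNzRingType) (u v w : 'cV[R]_3) : 'M[R]_3 :=
  \matrix_(i, j) (if j == i0 then u else if j == i1 then v else w) i 0.

Definition det3 (R : comNzRingType) (u v w : 'cV[R]_3) : R :=
  \det (col3_mx u v w).

Lemma det3_mulmx (R : comNzRingType) (A : 'M[R]_3) (u v w : 'cV[R]_3) :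
  det3 (A *m u) (A *m v) (A *m w) = \det A * det3 u v w.
Proof.
rewrite /det3 -det_mulmx; congr (\det _); apply/matrixP=> i j; rewrite !mxE.
by case Ej0: (j == i0); [|case Ej1: (j == i1)]; rewrite mxE;
  apply: eq_bigr => k _; rewrite mxE ?Ej0 ?Ej1.
Qed.

Lemma big_ord3 (T : Type) (idx : T) (op : Monoid.law idx) (E : 'I_3 -> T) :
  \big[op/idx]_i E i = op (op (E i0) (E i1)) (E i2).
Proof.
rewrite !big_ord_recl big_ord0 Monoid.mulm1 Monoid.mulmA.
by congr (op (op (E _) (E _)) (E _)); apply: val_inj.
Qed.

Lemma det3E (R : comNzRingType) (u v w : 'cV[R]_3) :
  det3 u v w = u i0 0 * (v i1 0 * w i2 0 - v i2 0 * w i1 0)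
             + u i1 0 * (v i2 0 * w i0 0 - v i0 0 * w i2 0)
             + u i2 0 * (v i0 0 * w i1 0 - v i1 0 * w i0 0).
Proof.
have liftE (h k : 'I_3) (m : 'I_2) :
  bump h m = k -> lift h m = k by move=> hmk; apply: val_inj.
have lift00 : lift ord0 ord0 = ord_max :> 'I_2 by apply: val_inj.
have lift10 : lift ord_max 0 = 0 :> 'I_2 by apply: val_inj.
rewrite /det3 (expand_det_col _ i0) big_ord3 /cofactor.
do 3!rewrite (expand_det_col _ 0) !big_ord_recl big_ord0 /cofactor !det_mx11.
rewrite !mxE /= !(lift00, lift10) !(@liftE i0 i1 0, @liftE i0 i2 ord_max) //=.
rewrite !(@liftE i1 i0 0, @liftE i1 i2 ord_max) //=.
rewrite !(@liftE i2 i0 0, @liftE i2 i1 ord_max) //=.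
rewrite /bump /=; ring.
Qed.

(** * Frobenius powers of matrices *)

Lemma expr_sum_pnat (R : comNzRingType) (q : nat) (I : Type) (r : seq I)
    (P : pred I) (E : I -> R) :
  [pchar R].-nat q ->
  (\sum_(i <- r | P i) E i) ^+ q = \sum_(i <- r | P i) E i ^+ q.
Proof.
move=> Rq; have q_gt0 : (0 < q)%N by case/andP: Rq.
apply: (big_morph (fun x : R => x ^+ q)) => [x y|]; first exact: exprDn_pchar.
by rewrite expr0n gtn_eqF.
Qed.

Definition frobmx (R : comNzRingType) (q m n : nat) (A : 'M[R]_(m, n)) :=
  map_mx (fun x => x ^+ q) A.

Lemma frobmx_mul (R : comNzRingType) (q m n p : nat)
    (A : 'M[R]_(m, n)) (B : 'M[R]_(n, p)) :
  [pchar R].-nat q -> frobmx q (A *m B) = frobmx q A *m frobmx q B.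
Proof.
move=> Rq; apply/matrixP=> i k; rewrite !mxE expr_sum_pnat //.
by apply: eq_bigr => j _; rewrite !mxE exprMn.
Qed.

Lemma pchar_nat_card (F : finFieldType) (R : nzRingType)
    (iota : {rmorphism F -> R}) : [pchar R].-nat #|F|.
Proof.
have [p p_pr pcharFp] := finPcharP F.
rewrite (card_pprimeChar pcharFp) pnatX; apply/orP; left.
by rewrite pnatE // (rmorph_pchar iota pcharFp).
Qed.

(** * Roots in finite fields *)

Lemma root_dvd_finField (K : finFieldType) (h : {poly K}) :
  size h != 1%N -> h %| 'X^#|K| - 'X -> exists x, root h x.
Proof.
rewrite finField_genPoly => sz_h /dvdp_prod_XsubC[m h_m].
have root_h := eqp_root h_m.
case def_s: (mask m _) => [|x s] in h_m root_h *.
  by move: sz_h; rewrite (eqp_size h_m) big_nil size_poly1 eqxx.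
by exists x; rewrite root_h big_cons rootM root_XsubC eqxx.
Qed.

Lemma iter_expn_fix (R : nzRingType) (x : R) (q n : nat) :
  x ^+ q = x -> x ^+ (q ^ n) = x.
Proof.
move=> xq; elim: n => [|n IHn]; first by rewrite expn0 expr1.
by rewrite expnS exprM xq.
Qed.

(** In the field F[X] / (p), of cardinal #|F| ^ deg p, the class of X is fixed
    by the power map with that exponent, hence by its iterates. *)
Lemma irreducible_dvd_XnsubX (F : finFieldType) (p : {poly F}) (n : nat) :
  p \is monic -> irreducible_poly p ->
  p %| 'X^((#|F| ^ (size p).-1) ^ n) - 'X.
Proof.
move=> p_mon p_irr.
have hI : monic_irreducible_poly p by split.
pose x : {poly %/ p with hI} := in_qpoly p 'X.
have : x ^+ ((#|F| ^ (size p).-1) ^ n) = x.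
  by apply: iter_expn_fix; rewrite -(card_qfpoly hI) expf_card.
rewrite /x -rmorphXn /= => /eqP; rewrite -subr_eq0 -rmorphB /=.
move/eqP/(congr1 val).
by rewrite /= mk_monicE // => /Pdiv.Ring.rmodp_eq0P; rewrite -dvdpE.
Qed.

(** The polynomial X^n - b divides X^N - b^(N / n) = X^N - 1 for
    N = #|K| - 1, so it splits over K. *)
Lemma finField_nth_root (K : finFieldType) (b : K) (n : nat) :
  (n %| #|K|.-1)%N -> b ^+ (#|K|.-1 %/ n) = 1 -> exists t, t ^+ n = b.
Proof.
move=> n_dvd b1; have K_gt1 := finNzRing_gt1 K.
have n_gt0 : (0 < n)%N by apply: dvdn_gt0 n_dvd; rewrite -ltnS prednK // ltnW.
have [||t] := @root_dvd_finField K ('X^n - b%:P).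
- by rewrite size_XnsubC // eqSS -lt0n.
- set m := (#|K|.-1 %/ n)%N in b1 *.
  have -> : 'X^#|K| - 'X = 'X * (('X^n) ^+ m - b%:P ^+ m).
    rewrite -exprM mulnC divnK // -rmorphXn b1 mulrBr mulr1 -exprS.
    by rewrite prednK // ltnW.
  by rewrite dvdp_mull // subrXX dvdp_mulr.
by rewrite rootE !hornerE subr_eq0 => /eqP <-; exists t.
Qed.

(** * An eigenbasis permuted by Frobenius *)

Lemma unitmx_distinct_eigenrows (K : fieldType) (n : nat) (U A : 'M[K]_n)
    (d : 'rV[K]_n) :
  U *m A = diag_mx d *m U -> injective (d 0) -> (forall i, row i U != 0) ->
  U \in unitmx.
Proof.
move=> UA d_inj U_nz.
(* A row relation w between the eigenrows stays a relation after A - c is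
   applied, which multiplies its k-th coefficient by d_k - c; taking for c
   the eigenvalues other than d_i leaves only the i-th coefficient. *)
have filterU (s : seq K) (w : 'rV_n) : w *m U = 0 ->
    (\row_k (w 0 k * \prod_(c <- s) (d 0 k - c))) *m U = 0.
  elim: s w => [|c s IHs] w wU0.
    rewrite -[RHS]wU0; congr (_ *m _); apply/rowP=> k.
    by rewrite mxE big_nil mulr1.
  have: w *m (diag_mx d - c%:M) *m U = 0.
    rewrite -mulmxA mulmxBl -UA mul_scalar_mx -mul_mx_scalar -mulmxBr.
    by rewrite mulmxA wU0 mul0mx.
  move/IHs => /(etrans _); apply; congr (_ *m _); apply/rowP=> k.
  rewrite mulmxBr mul_mx_diag mul_mx_scalar !mxE big_cons mulrA.
  by rewrite mulrBr [c * _]mulrC.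
rewrite -row_free_unit -kermx_eq0; apply/rowV0P=> w /sub_kermxP wU0.
apply/rowP=> i; rewrite mxE; apply/eqP.
pose s := [seq d 0 j | j <- enum 'I_n & j != i].
pose a := \prod_(c <- s) (d 0 i - c).
have := filterU s w wU0; set v := \row_k _.
have -> : v = (w 0 i * a) *: delta_mx 0 i.
  apply/rowP=> k; rewrite !mxE eqxx /=; have [->|k'i] := eqVneq k i.
    by rewrite mulr1.
  apply/eqP; rewrite mulr0 mulf_eq0 prodf_seq_eq0; apply/orP; right.
  apply/hasP; exists (d 0 k); last by rewrite /= subrr.
  by rewrite map_f // mem_filter k'i mem_enum.
rewrite -scalemxAl -rowE => /eqP.
rewrite scaler_eq0 (negPf (U_nz i)) orbF mulf_eq0 => /orP[//|].
rewrite prodf_seq_eq0 => /hasP[c /mapP[j]].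
rewrite mem_filter => /andP[j'i _] -> /=.
by rewrite subr_eq0 => /eqP/d_inj ij; rewrite ij eqxx in j'i.
Qed.

(** X^q - X already has q roots in F, so it has no other root in K. *)
Lemma frobenius_fixed (F : finFieldType) (K : fieldType)
    (iota : {rmorphism F -> K}) (x : K) :
  x ^+ #|F| = x -> exists a, x = iota a.
Proof.
move=> xq.
have /(congr1 (fun p => (map_poly iota p).[x])) := finField_genPoly F.
rewrite rmorphB rmorph_prod /= map_polyXn map_polyX !hornerE xq subrr.
rewrite horner_prod => /esym/eqP; rewrite prodf_seq_eq0 => /hasP[a _ /=].
rewrite rmorphB /= map_polyX map_polyC !hornerE subr_eq0 => /eqP ->.
by exists a.
Qed.

Lemma cubic_root_frobenius (F K : finFieldType) (iota : {rmorphism F -> K})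
    (p : {poly F}) (n : nat) :
  #|K| = ((#|F| ^ 3) ^ n)%N -> p \is monic -> size p = 4%N ->
  (forall a, ~~ root p a) ->
  exists x, [/\ root (map_poly iota p) x, x ^+ (#|F| ^ 3) = x & x ^+ #|F| != x].
Proof.
move=> cardK p_mon sz_p p_noroot.
have p_irr : irreducible_poly p by apply: cubic_irreducible; rewrite ?sz_p.
have p_dvd m : map_poly iota p %| 'X^((#|F| ^ 3) ^ m) - 'X.
  have := irreducible_dvd_XnsubX m p_mon p_irr; rewrite sz_p /=.
  by rewrite -(dvdp_map iota) rmorphB /= map_polyXn map_polyX.
have [||x px0] := @root_dvd_finField K (map_poly iota p).
- by rewrite size_map_poly sz_p.
- by rewrite cardK.
exists x; split=> //.
  have := dvdp_trans (_ : 'X - x%:P %| _) (p_dvd 1%N).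
  rewrite dvdp_XsubCl px0 => /(_ isT); rewrite dvdp_XsubCl expn1 rootE.
  by rewrite !hornerE subr_eq0 => /eqP.
apply: contraL px0 => /eqP/(@frobenius_fixed _ _ iota)[a ->].
by rewrite fmorph_root.
Qed.

(** The eigenvectors are obtained from one of them by Frobenius, which fixes M.
    The last clause contains a closing condition: Frobenius must take the third
    row back to the first.  It takes it to an eigenvector for the same
    eigenvalue, hence to a multiple of the first row; the two are equal once
    the first row is normalized to have a coordinate equal to 1. *)
Lemma cubic_eigenbasis (F K : finFieldType) (iota : {rmorphism F -> K})
    (M : 'M[F]_3) (n : nat) :
  #|K| = ((#|F| ^ 3) ^ n)%N -> (forall a, ~~ eigenvalue M a) ->
  exists (x : K) (U : 'M[K]_3),
    [/\ x ^+ (#|F| ^ 3) = x, x ^+ #|F| != x, U \in unitmx,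
        U *m map_mx iota M = diag_mx (\row_i x ^+ (#|F| ^ i)) *m U
      & forall i j : 'I_3, U i j ^+ #|F| = U (ordS i) j].
Proof.
set q := #|F| => cardK M_noeig.
have [||||x [px0 xq3 xq]] := @cubic_root_frobenius F K iota (char_poly M) n.
- by [].
- exact: char_poly_monic.
- exact: size_char_poly.
- by move=> a; rewrite -eigenvalue_root_char.
move: px0; rewrite map_char_poly -eigenvalue_root_char.
case/eigenvalueP=> u0 u0M /rV0Pn[k u0k].
pose u := (u0 0 k)^-1 *: u0.
have uM : u *m map_mx iota M = x *: u.
  by rewrite -scalemxAl u0M !scalerA mulrC.
have fixF (a : F) i : iota a ^+ (q ^ i) = iota a.
  by apply: iter_expn_fix; rewrite -rmorphXn /= expf_card.
have pcharK i : [pchar K].-nat (q ^ i)%N.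
  by rewrite pnatX (pchar_nat_card iota).
have frobM i :
    frobmx (q ^ i) u *m map_mx iota M = x ^+ (q ^ i) *: frobmx (q ^ i) u.
  have -> : map_mx iota M = frobmx (q ^ i) (map_mx iota M).
    by apply/matrixP=> a b; rewrite !mxE fixF.
  by rewrite -frobmx_mul // uM; apply/rowP=> a; rewrite !mxE exprMn.
have q_inj : injective (fun y : K => y ^+ q).
  move=> y z yz; have := exprDn_pchar (y - z) z (pcharK 1%N).
  rewrite expn1 subrK yz -[LHS]add0r => /addIr/esym/eqP.
  by rewrite expf_eq0 subr_eq0 => /andP[_ /eqP].
pose d : 'rV[K]_3 := \row_i x ^+ (q ^ i).
pose U : 'M[K]_3 := \matrix_i frobmx (q ^ i) u.
have UM : U *m map_mx iota M = diag_mx d *m U.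
  apply/row_matrixP=> i; rewrite row_mul rowK frobM.
  by apply/rowP=> j; rewrite mul_diag_mx !mxE.
have d_inj : injective (d 0).
  have x01 : x != x ^+ q by rewrite eq_sym.
  have x12 : x ^+ q != x ^+ (q ^ 2) by rewrite expnS expn1 exprM (inj_eq q_inj).
  have x20 : x ^+ (q ^ 2) != x.
    by rewrite -(inj_eq q_inj) -exprM -expnSr xq3.
  move=> i j; rewrite !mxE => dij; apply: val_inj; move: i j dij.
  case=> [[|[|[|//]]] ?] [[|[|[|//]]] ?] //=;
    rewrite ?expn0 ?expn1 ?expr1 => /eqP;
    by rewrite ?(negPf x01) ?(negPf x12) ?(negPf x20) // eq_sym
               ?(negPf x01) ?(negPf x12) ?(negPf x20).
have Uunit : U \in unitmx.
  apply: (unitmx_distinct_eigenrows UM d_inj) => i.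
  apply/negP=> /eqP/rowP/(_ k).
  by rewrite !mxE mulVf // expr1n; apply/eqP; rewrite oner_neq0.
have uq3 : frobmx (q ^ 3) u = u.
  pose y := frobmx (q ^ 3) u *m invmx U.
  have yU : y *m U = frobmx (q ^ 3) u by rewrite mulmxKV.
  have yd : y *m diag_mx d = x *: y.
    apply: (can_inj (mulmxK Uunit)); rewrite -mulmxA -UM mulmxA yU.
    by rewrite frobM xq3 -scalemxAl yU.
  have y0 : y = y 0 0 *: delta_mx 0 0.
    apply/rowP=> j; rewrite !mxE eqxx /=; have [->|j'0] := eqVneq j 0.
      by rewrite mulr1.
    have /rowP/(_ j) := yd; rewrite mul_mx_diag !mxE => /eqP.
    rewrite mulrC -subr_eq0 -mulrBl mulf_eq0 subr_eq0 mulr0 => /orP[|/eqP //].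
    have /(_ j 0) := inj_eq d_inj; rewrite !mxE expn0 expr1 => ->.
    by rewrite (negPf j'0).
  have [b u3] : exists b, frobmx (q ^ 3) u = b *: u.
    exists (y 0 0); rewrite -yU {1}y0 -scalemxAl -rowE rowK; congr (_ *: _).
    by apply/rowP=> j; rewrite !mxE.
  have /rowP/(_ k) := u3; rewrite !mxE mulVf // expr1n mulr1 => b1.
  by rewrite u3 -b1 scale1r.
have UE i j : U i j = u 0 j ^+ (q ^ i) by rewrite [LHS]mxE [LHS]mxE.
exists x, U; split=> // i j; rewrite !UE -exprM -expnSr.
case: i => [[|[|[|//]]]] //= _.
by have /rowP/(_ j) := uq3; rewrite [LHS]mxE expr1.
Qed.

(** * The forms det (M X, X, X^q) *)

Definition varcol (R : comNzRingType) : 'cV[{mpoly R[3]}]_3 := \col_i 'X_i.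

Definition det_form (R : comNzRingType) (q : nat) (M : 'M[R]_3) :
    {mpoly R[3]} :=
  det3 (map_mx (@mpolyC 3 R) M *m varcol R) (varcol R) (frobmx q (varcol R)).

Lemma linear_formE (R : comNzRingType) (n : nat) (A : 'M[R]_(n, 3)) (i : 'I_n) :
  (map_mx (@mpolyC 3 R) A *m varcol R) i 0 = \sum_j A i j *: 'X_j.
Proof. by rewrite mxE; apply: eq_bigr => j _; rewrite !mxE mul_mpolyC. Qed.

Lemma det_formE (R : comNzRingType) (q : nat) (M : 'M[R]_3)
    (L := fun i => \sum_j M i j *: 'X_j) :
  det_form q M = L i0 * ('X_i1 * 'X_i2 ^+ q - 'X_i2 * 'X_i1 ^+ q)
               + L i1 * ('X_i2 * 'X_i0 ^+ q - 'X_i0 * 'X_i2 ^+ q)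
               + L i2 * ('X_i0 * 'X_i1 ^+ q - 'X_i1 * 'X_i0 ^+ q).
Proof. by rewrite /det_form det3E !linear_formE !mxE. Qed.

Lemma det3_linear (R : comNzRingType) (a : R) (t u v w : 'cV[R]_3) :
  det3 (a *: t + u) v w = a * det3 t v w + det3 u v w.
Proof. by rewrite !det3E !mxE; ring. Qed.

Lemma det_form_linear (R : comNzRingType) (q : nat) : linear (@det_form R q).
Proof.
move=> a A B; rewrite /det_form -mul_mpolyC -det3_linear; congr (det3 _ _ _).
by rewrite map_mxD map_mxZ mulmxDl scalemxAl.
Qed.

Lemma det_form0 (R : comNzRingType) (q : nat) : det_form q (0 : 'M[R]_3) = 0.
Proof.
have := @det_form_linear R q (-1) 0 0.
by rewrite scaler0 addr0 scaleN1r addNr.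
Qed.

Lemma det3_col2 (R : comNzRingType) (u v : 'cV[R]_3) : det3 u v v = 0.
Proof. by rewrite det3E; ring. Qed.

Lemma det3_map (R S : comNzRingType) (h : {rmorphism R -> S})
    (u v w : 'cV[R]_3) :
  h (det3 u v w) = det3 (map_mx h u) (map_mx h v) (map_mx h w).
Proof.
rewrite /det3 -det_map_mx; congr (\det _); apply/matrixP=> i j; rewrite !mxE.
by case: (j == i0); case: (j == i1); rewrite mxE.
Qed.

Lemma det_form_vanish (F : finFieldType) (M : 'M[F]_3) (v : 'I_3 -> F) :
  (det_form #|F| M).@[v] = 0.
Proof.
rewrite /det_form det3_map.
have -> : map_mx (meval v) (frobmx #|F| (varcol F))
    = map_mx (meval v) (varcol F).
  by apply/matrixP=> i j; rewrite !mxE rmorphXn /= expf_card.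
exact: det3_col2.
Qed.

Lemma det_form_map (R S : comNzRingType) (h : {rmorphism R -> S}) (q : nat)
    (M : 'M[R]_3) :
  map_mpoly h (det_form q M) = det_form q (map_mx h M).
Proof.
have varE : map_mx (map_mpoly h) (varcol R) = varcol S.
  by apply/matrixP=> i j; rewrite !mxE map_mpolyX.
rewrite /det_form (det3_map (map_mpoly h)) (map_mxM (map_mpoly h)) varE.
have -> : map_mx (map_mpoly h) (map_mx (@mpolyC 3 R) M)
    = map_mx (@mpolyC 3 S) (map_mx h M).
  by apply/matrixP=> i j; rewrite !mxE map_mpolyC.
congr det3.
by apply/matrixP=> i j; rewrite !mxE rmorphXn /= map_mpolyX.
Qed.

Lemma ord3P (i : 'I_3) : [\/ i = i0, i = i1 | i = i2].
Proof.
by case: i => [[|[|[|//]]] ?]; [apply: Or31 | apply: Or32 | apply: Or33];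
   apply: val_inj.
Qed.

(** The elementary matrix M = E_lk gives X_k times the minor of X and X^q that
    omits the row l, up to sign. *)
Lemma exists_det_form (R : comNzRingType) (q : nat) (i j k : 'I_3) :
  exists M : 'M[R]_3,
    'X_k * ('X_i ^+ q * 'X_j - 'X_i * 'X_j ^+ q) = det_form q M.
Proof.
have LE (l h : 'I_3) (c : R) :
    \sum_j (c *: delta_mx l k) h j *: 'X_j
      = (c * (h == l)%:R) *: 'X_k :> {mpoly R[3]}.
  rewrite (bigD1 k) //= big1 => [|a a'k]; rewrite !mxE ?eqxx ?andbT ?addr0 //.
  by rewrite (negPf a'k) andbF mulr0 scale0r.
have [i_0|i_1|i_2] := ord3P i; have [j_0|j_1|j_2] := ord3P j; subst i j.
- by exists 0; rewrite det_form0; ring.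
- exists (-1 *: delta_mx i2 k); rewrite det_formE !LE /=.
  by rewrite !(mulr0, mulr1, scale0r, scale1r, scaleN1r); ring.
- exists (1 *: delta_mx i1 k); rewrite det_formE !LE /=.
  by rewrite !(mulr0, mulr1, scale0r, scale1r, scaleN1r); ring.
- exists (1 *: delta_mx i2 k); rewrite det_formE !LE /=.
  by rewrite !(mulr0, mulr1, scale0r, scale1r, scaleN1r); ring.
- by exists 0; rewrite det_form0; ring.
- exists (-1 *: delta_mx i0 k); rewrite det_formE !LE /=.
  by rewrite !(mulr0, mulr1, scale0r, scale1r, scaleN1r); ring.
- exists (-1 *: delta_mx i1 k); rewrite det_formE !LE /=.
  by rewrite !(mulr0, mulr1, scale0r, scale1r, scaleN1r); ring.
- exists (1 *: delta_mx i0 k); rewrite det_formE !LE /=.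
  by rewrite !(mulr0, mulr1, scale0r, scale1r, scaleN1r); ring.
- by exists 0; rewrite det_form0; ring.
Qed.

(** * Forms vanishing at all points of the plane *)

(** These are the monomials of degree q + 2 divisible by no X_i^q X_j with
    i < j; modulo the forms det (M X, X, X^q), each such X_i^q X_j can be
    replaced with X_i X_j^q. *)
Definition reduced_mnm (q : nat) (m : 'X_{1..3}) : bool :=
  (mdeg m == q + 2)%N &&
  (if m i2 == 0%N then (m i0 < q)%N || (m i1 == 0%N)
   else (m i0 < q)%N && (m i1 < q)%N).

Definition reduces (R : comNzRingType) (q : nat) (f : {mpoly R[3]}) : Prop :=
  exists (M : 'M[R]_3) (r : {mpoly R[3]}),
    f = det_form q M + r /\ forall m, r@_m != 0 -> reduced_mnm q m.

Lemma mdeg3E (m : 'X_{1..3}) : mdeg m = (m i0 + m i1 + m i2)%N.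
Proof. by rewrite mdegE big_ord3. Qed.

Lemma reduces0 (R : comNzRingType) (q : nat) : reduces q (0 : {mpoly R[3]}).
Proof.
exists 0, 0; split=> [|m]; last by rewrite mcoeff0 eqxx.
by rewrite det_form0 addr0.
Qed.

Lemma reduces_comb (R : comNzRingType) (q : nat) (c : R) (f g : {mpoly R[3]}) :
  reduces q f -> reduces q g -> reduces q (c *: f + g).
Proof.
move=> [A [r [-> r_red]]] [B [s [-> s_red]]].
exists (c *: A + B), (c *: r + s); split.
  by rewrite det_form_linear scalerDr; exact: addrACA.
move=> m; rewrite mcoeffD mcoeffZ; have [r0|/r_red //] := eqVneq r@_m 0.
by rewrite r0 mulr0 add0r => /s_red.
Qed.

Lemma reduces_swap (R : comNzRingType) (q : nat) (i j k : 'I_3) :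
  reduces q ('X_k * ('X_i * 'X_j ^+ q) : {mpoly R[3]}) ->
  reduces q ('X_k * ('X_i ^+ q * 'X_j) : {mpoly R[3]}).
Proof.
move=> red; have [M M_eq] := exists_det_form R q i j k.
have redM : reduces q (det_form q M).
  by exists M, 0; rewrite addr0; split=> // m; rewrite mcoeff0 eqxx.
have := reduces_comb 1 redM red; rewrite scale1r -M_eq -mulrDr subrK.
by [].
Qed.

Definition mon3 (R : comNzRingType) (a b c : nat) : {mpoly R[3]} :=
  'X_i0 ^+ a * 'X_i1 ^+ b * 'X_i2 ^+ c.

Lemma mpolyX3E (R : comNzRingType) (m : 'X_{1..3}) :
  'X_[m] = mon3 R (m i0) (m i1) (m i2).
Proof. by rewrite mpolyXE_id big_ord3. Qed.

Lemma reduces_reduced (R : comNzRingType) (q : nat) (m : 'X_{1..3}) :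
  reduced_mnm q m -> reduces q ('X_[m] : {mpoly R[3]}).
Proof.
move=> m_red; exists 0, 'X_[m]; split; first by rewrite det_form0 add0r.
by move=> k; rewrite mcoeffX; case: (m =P k) => [<- //|_]; rewrite eqxx.
Qed.

(** In degree q + 2 with q > 1 an exponent that is at least q leaves degree at
    most 2 for the rest, so only eight monomials need reduction.  Each takes
    one swap, after which it is reduced, except that X_i^2 X_j^q calls for a
    second swap when q = 2. *)
Lemma reduces_mon3 (R : comNzRingType) (q a b c : nat) :
  (1 < q)%N -> (a + b + c = q + 2)%N -> reduces q (mon3 R a b c).
Proof.
move=> q_gt1 abc.
pose m a b c : 'X_{1..3} := [multinom [tuple a; b; c]].
have mE a' b' c' : mon3 R a' b' c' = 'X_[m a' b' c'].
  by rewrite mpolyX3E.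
have base a' b' c' : (a' + b' + c' = q + 2)%N ->
    (if c' == 0%N then (a' < q)%N || (b' == 0%N)
     else (a' < q)%N && (b' < q)%N) ->
    reduces q (mon3 R a' b' c').
  move=> s red; rewrite mE; apply: reduces_reduced.
  by rewrite /reduced_mnm mdeg3E s eqxx.
have swap (i j k : 'I_3) (f g : {mpoly R[3]}) :
    f = 'X_k * ('X_i ^+ q * 'X_j) -> g = 'X_k * ('X_i * 'X_j ^+ q) ->
    reduces q (g : {mpoly R[3]}) -> reduces q f.
  by move=> -> ->; apply: reduces_swap.
have red_q20 : reduces q (mon3 R q 2 0).
  apply: (swap i0 i1 i1 _ (mon3 R 1 q.+1 0)).
  1,2: by rewrite /mon3 ?exprS; ring.
  by apply: base => /=; lia.
have red_q02 : reduces q (mon3 R q 0 2).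
  apply: (swap i0 i2 i2 _ (mon3 R 1 0 q.+1)).
  1,2: by rewrite /mon3 ?exprS; ring.
  by apply: base => /=; lia.
have red_0q2 : reduces q (mon3 R 0 q 2).
  apply: (swap i1 i2 i2 _ (mon3 R 0 1 q.+1)).
  1,2: by rewrite /mon3 ?exprS; ring.
  by apply: base => /=; lia.
have red_2q0 : reduces q (mon3 R 2 q 0).
  have [q2|q_neq2] := eqVneq q 2%N; first by move: red_q20; rewrite q2.
  by apply: base => /=; lia.
have red_20q : reduces q (mon3 R 2 0 q).
  have [q2|q_neq2] := eqVneq q 2%N; first by move: red_q02; rewrite q2.
  by apply: base; [lia | case: ifP; lia].
have red_02q : reduces q (mon3 R 0 2 q).
  have [q2|q_neq2] := eqVneq q 2%N; first by move: red_0q2; rewrite q2.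
  by apply: base; [lia | case: ifP; lia].
have red_q11 : reduces q (mon3 R q 1 1).
  apply: (swap i0 i2 i1 _ (mon3 R 1 1 q)).
  1,2: by rewrite /mon3; ring.
  by apply: base; [lia | case: ifP; lia].
have red_1q1 : reduces q (mon3 R 1 q 1).
  apply: (swap i1 i2 i0 _ (mon3 R 1 1 q)).
  1,2: by rewrite /mon3; ring.
  by apply: base; [lia | case: ifP; lia].
have red_Sq10 : reduces q (mon3 R q.+1 1 0).
  apply: (swap i0 i1 i0 _ (mon3 R 2 q 0)).
  1,2: by rewrite /mon3 ?exprS; ring.
  by [].
have red_Sq01 : reduces q (mon3 R q.+1 0 1).
  apply: (swap i0 i2 i0 _ (mon3 R 2 0 q)).
  1,2: by rewrite /mon3 ?exprS; ring.
  by [].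
have red_0Sq1 : reduces q (mon3 R 0 q.+1 1).
  apply: (swap i1 i2 i1 _ (mon3 R 0 2 q)).
  1,2: by rewrite /mon3 ?exprS; ring.
  by [].
have [normal|] := boolP (if c == 0%N then (a < q)%N || (b == 0%N)
                         else (a < q)%N && (b < q)%N); first exact: base.
have use a' b' c' : a = a' -> b = b' -> c = c' -> reduces q (mon3 R a' b' c') ->
    reduces q (mon3 R a b c) by move=> -> -> ->.
case: ifP => [/eqP c0|c_neq0 ab].
  rewrite negb_or -leqNgt => /andP[qa b_neq0].
  have [a_q|a_neq] := eqVneq a q; first by apply: use red_q20; lia.
  by apply: use red_Sq10; lia.
have [aq|qa] := ltnP a q.
  have [a1|a_neq1] := eqVneq a 1%N; first by apply: use red_1q1; lia.
  have [c1|c_neq1] := eqVneq c 1%N; first by apply: use red_0Sq1; lia.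
  by apply: use red_0q2; lia.
have [b1|b_neq1] := eqVneq b 1%N; first by apply: use red_q11; lia.
have [c1|c_neq1] := eqVneq c 1%N; first by apply: use red_Sq01; lia.
by apply: use red_q02; lia.
Qed.

Lemma reduces_homog (R : comNzRingType) (q : nat) (f : {mpoly R[3]}) :
  (1 < q)%N -> f \is (q + 2).-homog -> reduces q f.
Proof.
move=> q_gt1 /dhomogP f_homog; rewrite (mpolyE f) big_seq.
apply: (big_ind (reduces q)) => [|g h red_g red_h|m /f_homog m_deg].
- exact: reduces0.
- by rewrite -[g]scale1r; apply: reduces_comb.
- rewrite -[_ *: _]addr0; apply: reduces_comb; last exact: reduces0.
  by rewrite mpolyX3E; apply: reduces_mon3; rewrite // -mdeg3E.
Qed.

(** Grouping the terms by exponent makes a polynomial of degree less than #|F|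
    vanishing on F, whose coefficients are then 0.  Grouping instead of assuming
    distinct exponents allows one variable to be separated after another. *)
Lemma separate_powers (F : finFieldType) (I : eqType) (s : seq I) (P : pred I)
    (c : I -> F) (e : I -> nat) :
  {in s, forall i, P i -> (e i < #|F|)%N} ->
  (forall x, \sum_(i <- s | P i) c i * x ^+ e i = 0) ->
  forall a, \sum_(i <- s | P i && (e i == a)) c i = 0.
Proof.
move=> e_lt vanish a.
pose p : {poly F} := \sum_(i <- s | P i) c i *: 'X^(e i).
have coef_p k : p`_k = \sum_(i <- s | P i && (e i == k)) c i.
  rewrite coef_sum big_mkcondr /=; apply: eq_bigr => i _.
  by rewrite coefZ coefXn eq_sym; case: eqP; rewrite ?mulr1 ?mulr0.
suff p0 : p = 0 by rewrite -coef_p p0 coef0.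
apply: contraTeq (finNzRing_gt1 F) => p_nz; rewrite -leqNgt.
have : (size p <= #|F|)%N.
  apply/leq_sizeP=> k le_k; rewrite coef_p big1_seq // => i.
  by case/andP=> /andP[Pi /eqP ek] /e_lt/(_ Pi); rewrite ek ltnNge le_k.
rewrite leqNgt cardE (max_poly_roots p_nz) ?enum_uniq //.
apply/allP=> x _; rewrite rootE horner_sum -[X in _ == X](vanish x).
by apply/eqP/eq_bigr => i _; rewrite !hornerE.
Qed.

Lemma sum_mcoeff_single (R : comNzRingType) (r : {mpoly R[3]})
    (P : pred 'X_{1..3}) (m : 'X_{1..3}) :
  {in msupp r, forall k, P k = (k == m)} ->
  \sum_(k <- msupp r | P k) r@_k = r@_m.
Proof.
move=> Pm; rewrite big_seq_cond.
rewrite (eq_bigl (fun k => (k \in msupp r) && (k == m))).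
  rewrite -big_seq_cond.
  have [m_r|m_r] := boolP (m \in msupp r).
    by rewrite -big_filter filter_pred1_uniq ?msupp_uniq // big_seq1.
  rewrite (memN_msupp_eq0 m_r) big_seq_cond big1 // => k /andP[k_r /eqP km].
  by rewrite -km k_r in m_r.
by move=> k; case: (boolP (k \in msupp r)) => //= /Pm.
Qed.

(** The points (1, 0, 0), (x, 1, 0) and (x, y, 1) detect in turn the monomial
    X_0^(q+2), the other monomials without X_2, and those with X_2. *)
Lemma reduced_vanish_eq0 (F : finFieldType) (r : {mpoly F[3]}) :
  (forall m, r@_m != 0 -> reduced_mnm #|F| m) -> contains_all_points r -> r = 0.
Proof.
set q := #|F| => r_red r_van.
have red m : m \in msupp r -> reduced_mnm q m.
  by rewrite mcoeff_msupp; apply: r_red.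
have ext (m k : 'X_{1..3}) : m i0 = k i0 -> m i1 = k i1 -> m i2 = k i2 -> m = k.
  by move=> h0 h1 h2; apply/mnmP=> i; case: (ord3P i) => ->.
have eval3 (a b c : F) : (a != 0) || (b != 0) || (c != 0) ->
    \sum_(m <- msupp r) r@_m * (a ^+ m i0 * b ^+ m i1 * c ^+ m i2) = 0.
  move=> nz; pose v : 'rV[F]_3 := \row_i tnth [tuple a; b; c] i.
  have v_nz : v != 0.
    apply: contraTneq nz => /rowP v0.
    by have := (v0 i0, v0 i1, v0 i2); rewrite !mxE /tnth /= => -[[-> ->] ->];
       rewrite eqxx.
  rewrite -[RHS](r_van v v_nz) mevalE; apply: eq_bigr => m _.
  by rewrite big_ord3 !mxE.
have red_deg m : m \in msupp r -> (m i0 + m i1 + m i2)%N = (q + 2)%N.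
  by move/red/andP=> [/eqP <- _]; rewrite mdeg3E.
have coef_x m : m \in msupp r -> m i1 = 0%N -> m i2 = 0%N -> r@_m = 0.
  move=> m_r m1 m2.
  rewrite -(@sum_mcoeff_single _ r (fun k => (k i1 == 0%N) && (k i2 == 0%N))).
    rewrite -[RHS](eval3 1 0 0) ?oner_eq0 // big_mkcond /=.
    apply: eq_bigr => k _; rewrite expr1n mul1r !expr0n.
    by case: eqP; case: eqP; rewrite ?mulr1 ?mulr0 ?mul0r.
  move=> k k_r; apply/andP/eqP => [[/eqP k1 /eqP k2]|->]; last by rewrite m1 m2.
  have dk := red_deg k k_r; have dm := red_deg m m_r.
  by apply: ext; lia.
have coef_xy m : m \in msupp r -> m i2 = 0%N -> r@_m = 0.
  move=> m_r m2.
  rewrite -(@sum_mcoeff_single _ r (fun k => (k i2 == 0%N) && (k i0 == m i0))).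
    apply: (separate_powers (e := fun k : 'X_{1..3} => k i0)).
      move=> k k_r /eqP k2; have /andP[_] := red k k_r; rewrite k2 /=.
      case/orP=> // /eqP k1; move: (k_r).
      by rewrite mcoeff_msupp coef_x ?eqxx.
    move=> x; rewrite -[RHS](eval3 x 1 0) ?oner_eq0 ?orbT // big_mkcond /=.
    apply: eq_bigr => k _; rewrite expr1n mulr1 expr0n.
    by case: eqP; rewrite ?mulr1 ?mulr0.
  move=> k k_r; apply/andP/eqP => [[/eqP k2 /eqP k0]|->]; last by rewrite m2.
  have dk := red_deg k k_r; have dm := red_deg m m_r.
  by apply: ext; lia.
have supp_z m : m \in msupp r -> [/\ m i2 != 0%N, (m i0 < q)%N & (m i1 < q)%N].
  move=> m_r; have m2 : m i2 != 0%N.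
    apply/eqP=> m2; move: (m_r); rewrite mcoeff_msupp coef_xy ?eqxx //.
  have /andP[_] := red m m_r; rewrite (negPf m2) => /andP[? ?]; by split.
apply/mpolyP=> m; rewrite mcoeff0.
have [m_r|] := boolP (m \in msupp r); last exact: memN_msupp_eq0.
rewrite -(@sum_mcoeff_single _ r (fun k => (k i0 == m i0) && (k i1 == m i1))).
  apply: (separate_powers (e := fun k : 'X_{1..3} => k i1)).
    by move=> k /supp_z[].
  move=> y.
  apply: (separate_powers (P := xpredT) (e := fun k : 'X_{1..3} => k i0)
                          (c := fun k => r@_k * y ^+ k i1)).
    by move=> k /supp_z[].
  move=> x; rewrite -[RHS](eval3 x y 1) ?oner_eq0 ?orbT //.
  by apply: eq_bigr => k _; rewrite expr1n mulr1 -mulrA [_ * x ^+ _]mulrC.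
move=> k k_r; apply/andP/eqP => [[/eqP k0 /eqP k1]|-> //].
have dk := red_deg k k_r; have dm := red_deg m m_r.
by apply: ext; lia.
Qed.

Lemma vanish_det_form (F : finFieldType) (f : {mpoly F[3]}) :
  f \is (#|F| + 2).-homog -> contains_all_points f ->
  exists M : 'M[F]_3, f = det_form #|F| M.
Proof.
move=> f_homog f_van.
have [M [r [f_eq r_red]]] := reduces_homog (finNzRing_gt1 F) f_homog.
exists M; rewrite f_eq (reduced_vanish_eq0 r_red) ?addr0 // => v v_nz.
by have := f_van v v_nz; rewrite f_eq mevalD det_form_vanish add0r.
Qed.

(** * Irreducibility excludes rational eigenvalues *)

(** Replacing row k with the combination a of the rows multiplies the
    determinant by a_k; the p_i are the minors of the other two rows. *)
Lemma det3_row_comb (R : comNzRingType) (a : 'rV[R]_3) (u v w : 'cV[R]_3)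
    (k : 'I_3) (b1 b2 b3 : R) :
  (a *m u) 0 0 = b1 -> (a *m v) 0 0 = b2 -> (a *m w) 0 0 = b3 ->
  exists p1 p2 p3, a 0 k * det3 u v w = b1 * p1 + b2 * p2 + b3 * p3.
Proof.
move=> <- <- <-.
pose m i j (x y : 'cV[R]_3) := x i 0 * y j 0 - x j 0 * y i 0.
have [->|->|->] := ord3P k.
- exists (m i1 i2 v w), (m i1 i2 w u), (m i1 i2 u v).
  by rewrite det3E !mxE !big_ord3 /m /=; ring.
- exists (m i2 i0 v w), (m i2 i0 w u), (m i2 i0 u v).
  by rewrite det3E !mxE !big_ord3 /m /=; ring.
- exists (m i0 i1 v w), (m i0 i1 w u), (m i0 i1 u v).
  by rewrite det3E !mxE !big_ord3 /m /=; ring.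
Qed.

Lemma pchar_mpoly (R : comNzRingType) (q : nat) :
  [pchar R].-nat q -> [pchar {mpoly R[3]}].-nat q.
Proof. by apply: sub_in_pnat => p _; apply: (rmorph_pchar (@mpolyC 3 R)). Qed.

(** An eigenvector u would make the linear form u X a factor of f.  The cofactor
    would then be a constant, whereas f has degree q + 2. *)
Lemma det_form_eigenvalue (F : finFieldType) (M : 'M[F]_3) :
  irreducible_mpoly (det_form #|F| M) ->
  det_form #|F| M \is (#|F| + 2).-homog -> forall a, ~~ eigenvalue M a.
Proof.
set f := det_form _ M => -[f_nunit f_irr] f_homog a.
apply/eigenvalueP=> -[u uM u_nz].
have [k uk] : exists k, u 0 k != 0 by apply/rV0Pn.
pose C := @mpolyC 3 F.
pose l : {mpoly F[3]} := \sum_j u 0 j *: 'X_j.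
have lE : map_mx C u *m varcol F = l%:M.
  by apply/matrixP=> i j; rewrite !ord1 linear_formE mxE.
have uM_l : (map_mx C u *m (map_mx C M *m varcol F)) 0 0 = C a * l.
  by rewrite mulmxA -map_mxM uM map_mxZ -scalemxAl lE !mxE.
have uX_l : (map_mx C u *m varcol F) 0 0 = l by rewrite lE mxE.
have uXq_l : (map_mx C u *m frobmx #|F| (varcol F)) 0 0 = l ^+ #|F|.
  have -> : map_mx C u = frobmx #|F| (map_mx C u).
    by apply/matrixP=> i j; rewrite !mxE -rmorphXn /= expf_card.
  rewrite -frobmx_mul ?lE; first by rewrite !mxE.
  exact/pchar_mpoly/(pchar_nat_card idfun).
have [p1 [p2 [p3]]] := det3_row_comb k uM_l uX_l uXq_l.
rewrite [map_mx C u 0 k]mxE -/f.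
have -> : l ^+ #|F| = l * l ^+ #|F|.-1.
  by rewrite -exprS prednK // ltnW // finNzRing_gt1.
pose h := (u 0 k)^-1 *: (C a * p1 + p2 + l ^+ #|F|.-1 * p3).
move=> f_eq; have f_lh : f = l * h.
  rewrite -scalerAr; apply: (scalerI uk); rewrite scalerA mulfV // scale1r.
  by rewrite -mul_mpolyC f_eq; ring.
have l_nunit : l \isn't a GRing.unit.
  apply/negP=> /(rmorph_unit (meval (fun=> 0))).
  rewrite raddf_sum /= big1 ?unitr0 // => j _.
  by rewrite mevalZ mevalXU mulr0.
have [l_unit|h_unit] := f_irr _ _ f_lh; first by rewrite l_unit in l_nunit.
have l_homog : l \is 1.-homog.
  by apply: rpred_sum => j _; apply: rpredZ; rewrite dhomogX /= mdeg1.
have f_nz : f != 0.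
  apply/eqP=> f0; have f00 : f = 0 * 0 by rewrite f0 mulr0.
  by have [] := f_irr _ _ f00; rewrite unitr0.
have f_homog1 : f \is 1.-homog.
  have /andP[/eqP h_const _] := h_unit.
  by rewrite f_lh h_const mulrC mul_mpolyC; apply: rpredZ.
by move/eqP: (dhomog_uniq f_nz f_homog f_homog1); rewrite addn2.
Qed.

(** * Reduction to the Pellikaan form *)

Lemma linear_subst_pellikaan (R : fieldType) (A : 'M[R]_3) (q : nat)
    (Z := fun i => \sum_j A i j *: 'X_j) :
  linear_subst A (pellikaan_form R q) =
    Z i1 ^+ (q + 1) * Z i2 + Z i2 ^+ (q + 1) * Z i0 + Z i0 ^+ (q + 1) * Z i1.
Proof.
rewrite /linear_subst /pellikaan_form; set lq := [tuple _ | _ < _].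
have ZE i : 'X_i \mPo lq = Z i.
  by rewrite comp_mpolyXU -tnth_nth tnth_mktuple.
have subM : {morph comp_mpoly lq : x y / x * y} := rmorphM (comp_mpoly lq).
have subX k : {morph comp_mpoly lq : x / x ^+ k} := rmorphXn (comp_mpoly lq) k.
by rewrite !comp_mpolyD !subM !subX !ZE.
Qed.

(** In the coordinates Y = U X the first column is D Y and, since U^q is U with
    its rows shifted, the third one has Y_i^q in row i + 1. *)
Lemma det_form_cyclic (K : fieldType) (q : nat) (N U : 'M[K]_3) (d : 'rV[K]_3)
    (Y := fun i => \sum_j U i j *: 'X_j) :
  [pchar K].-nat q -> U *m N = diag_mx d *m U ->
  (forall i j : 'I_3, U i j ^+ q = U (ordS i) j) ->
  \det U *: det_form q N =
      (d 0 i1 - d 0 i2) *: (Y i2 ^+ (q + 1) * Y i1)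
    + (d 0 i0 - d 0 i1) *: (Y i1 ^+ (q + 1) * Y i0)
    + (d 0 i2 - d 0 i0) *: (Y i0 ^+ (q + 1) * Y i2).
Proof.
move=> Kq UN Uq; pose C := @mpolyC 3 K.
have YE i : (map_mx C U *m varcol K) i 0 = Y i by rewrite linear_formE.
have DYE i : (map_mx C U *m (map_mx C N *m varcol K)) i 0 = C (d 0 i) * Y i.
  rewrite mulmxA -map_mxM UN linear_formE /C mul_mpolyC scaler_sumr.
  by apply: eq_bigr => j _; rewrite mul_diag_mx mxE scalerA.
have YqE i : (map_mx C U *m frobmx q (varcol K)) (ordS i) 0 = Y i ^+ q.
  rewrite expr_sum_pnat ?pchar_mpoly // mxE; apply: eq_bigr => j _.
  by rewrite !mxE -Uq exprZn mul_mpolyC.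
have [s0 s1 s2] : [/\ ordS i0 = i1, ordS i1 = i2 & ordS i2 = i0].
  by split; apply: val_inj.
have /(_ i0) := YqE; have /(_ i1) := YqE; have /(_ i2) := YqE.
rewrite s0 s1 s2 => Yq0 Yq2 Yq1.
have -> : \det U *: det_form q N = \det (map_mx C U) * det_form q N.
  by rewrite -mul_mpolyC (det_map_mx C).
rewrite -det3_mulmx.
move: (_ *m _) (_ *m _) (_ *m _) DYE YE Yq0 Yq1 Yq2 => w y z DYE YE Yq0 Yq1 Yq2.
rewrite det3E !DYE !YE Yq0 Yq1 Yq2.
have subE a b (p : {mpoly K[3]}) : (a - b) *: p = (C a - C b) * p.
  by rewrite -mpolyCB mul_mpolyC.
rewrite !subE !addn1 !exprSr.
ring.
Qed.

(** With #|K| - 1 = (Q - 1) S and S = 1 + Q + ... + Q^(n-1), one has S = n = 0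
    modulo n because Q = 1 modulo n.  Hence (#|K| - 1) / n is a multiple of
    Q - 1, and b raised to it is 1. *)
Lemma subfield_nth_root (K : finFieldType) (b : K) (Q n : nat) :
  (1 < Q)%N -> (0 < n)%N -> (n %| Q.-1)%N -> #|K| = (Q ^ n)%N ->
  b != 0 -> b ^+ Q = b -> exists t, t ^+ n = b.
Proof.
move=> Q_gt1 n_gt0 n_dvd cardK b_nz bQ.
have Q1_dvd i : (Q.-1 %| (Q ^ i).-1)%N by rewrite predn_exp dvdn_mulr.
have [k sumE] : exists k, (\sum_(i < n) Q ^ i = k * n)%N.
  apply/dvdnP.
  have -> : (\sum_(i < n) Q ^ i = \sum_(i < n) (Q ^ i).-1 + n)%N.
    rewrite -[X in (_ + X)%N]card_ord -sum1_card -big_split /=.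
    apply: eq_bigr => i _; rewrite addn1 prednK // expn_gt0.
    by rewrite (ltnW Q_gt1).
  by rewrite dvdn_addl // dvdn_sum // => i _; apply: dvdn_trans (Q1_dvd i).
have cardK1 : #|K|.-1 = (Q.-1 * k * n)%N by rewrite cardK predn_exp sumE mulnA.
apply: (@finField_nth_root K); first by rewrite cardK1 dvdn_mull.
rewrite cardK1 mulnK // exprM.
suff -> : b ^+ Q.-1 = 1 by rewrite expr1n.
by apply: (mulfI b_nz); rewrite mulr1 -exprS prednK // ltnW.
Qed.

(** Eliminating t1 and s leaves one condition on t2, which says that its power
    of exponent q^2 + q + 1 is a^(2q) / (a a^(q^2)). *)
Lemma equalizing_scalars (K : finFieldType) (q : nat) (a : K) :
  (1 < q)%N -> #|K| = ((q ^ 3) ^ (q ^ 2 + q + 1))%N ->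
  a != 0 -> a ^+ (q ^ 3) = a ->
  exists s t1 t2 : K, [/\ s != 0, t1 != 0 & t2 != 0] /\
    [/\ t1 ^+ (q + 1) * t2 = s * a ^+ q, t2 ^+ (q + 1) = s * a
      & t1 = s * a ^+ (q ^ 2)].
Proof.
set n := (_ + 1)%N => q_gt1 cardK a_nz aq3.
pose b := (a ^+ q) ^+ 2 / (a * a ^+ (q ^ 2)).
have pow_fix i : (a ^+ i) ^+ (q ^ 3) = a ^+ i by rewrite exprAC aq3.
have b_nz : b != 0 by rewrite !(mulf_neq0, invr_neq0, expf_neq0).
have [||||||t tn] := @subfield_nth_root K b (q ^ 3) n; rewrite ?cardK //.
- by rewrite -(expn0 q) ltn_exp2l.
- by rewrite /n addn1.
- rewrite predn_exp big_ord3 /=; apply: dvdn_mull; rewrite /n expn0 expn1.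
  suff -> : (1 + q + q ^ 2 = q ^ 2 + q + 1)%N by []; lia.
- by rewrite expr_div_n !exprMn !pow_fix aq3.
have t_nz : t != 0.
  by apply: contraNneq b_nz => t0; rewrite -tn t0 expr0n /n addn1.
pose s := t ^+ (q + 1) / a.
have s_nz : s != 0 by rewrite mulf_neq0 ?invr_neq0 ?expf_neq0.
exists s, (s * a ^+ (q ^ 2)), t; split.
  by split=> //; rewrite mulf_neq0 ?expf_neq0.
split=> //; last by rewrite divfK.
have sq : s ^+ q * t * a ^+ q = b.
  rewrite expr_div_n mulrAC divfK ?expf_neq0 // -exprM -exprSr -tn.
  by congr (_ ^+ _); rewrite /n; lia.
have aq : (a ^+ (q ^ 2)) ^+ q = a by rewrite -exprM -expnSr.
have bE : b * (a * a ^+ (q ^ 2)) = (a ^+ q) ^+ 2.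
  by rewrite divfK // mulf_neq0 ?expf_neq0.
rewrite exprMn !addn1 !exprS aq; apply: (mulIf (expf_neq0 q a_nz)).
transitivity (s * (s ^+ q * t * a ^+ q) * (a * a ^+ (q ^ 2))); first by ring.
by rewrite sq -(mulrA s b) bE; ring.
Qed.

Theorem theorem2p2 (q : nat) (F K : finFieldType) (iota : {rmorphism F -> K})
    (f : {mpoly F[3]})
    (hF : #|F| = q) (hK : #|K| = (q ^ (3 * (q ^ 2 + q + 1)))%N)
    (hf : tallini_curve f) :
  proj_equiv (map_mpoly iota f) (pellikaan_form K q).
Proof.
have q_gt1 : (1 < q)%N by rewrite -hF finNzRing_gt1.
have Kq : [pchar K].-nat q by rewrite -hF pchar_nat_card.
pose n := (q ^ 2 + q + 1)%N.
have cardK : #|K| = ((q ^ 3) ^ n)%N by rewrite hK expnM.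
case: hf => f_homog f_irr /(vanish_det_form f_homog)[M f_eq].
rewrite f_eq in f_homog f_irr.
have M_noeig := det_form_eigenvalue f_irr f_homog.
rewrite {}f_eq hF det_form_map {f_homog f_irr}.
have [||x [U]] := @cubic_eigenbasis F K iota M n; rewrite ?hF //.
case=> xq3 xq U_unit UN Uq.
have := det_form_cyclic Kq UN Uq; rewrite !mxE /= expr1.
pose a := x - x ^+ q.
have subq (y z : K) : (y - z) ^+ q = y ^+ q - z ^+ q.
  by apply/eqP; rewrite eq_sym subr_eq -exprDn_pchar // subrK.
have xqq : (x ^+ q) ^+ q = x ^+ (q ^ 2) by rewrite -exprM mulnn.
have xq2q : (x ^+ (q ^ 2)) ^+ q = x by rewrite -exprM -expnSr.
have aq : a ^+ q = x ^+ q - x ^+ (q ^ 2) by rewrite subq xqq.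
have aq2 : a ^+ (q ^ 2) = x ^+ (q ^ 2) - x.
  by rewrite -mulnn exprM aq subq xqq xq2q.
have aq3 : a ^+ (q ^ 3) = a by rewrite expnSr exprM aq2 subq xq2q.
have a_nz : a != 0 by rewrite subr_eq0 eq_sym.
rewrite -/a -aq -aq2.
have [s [t1 [t2 [[s_nz t1_nz t2_nz] [e1 e2 e0]]]]] :=
  equalizing_scalars q_gt1 cardK a_nz aq3.
pose t : 'rV[K]_3 := \row_i tnth [tuple 1; t1; t2] i.
(* The monomials obtained in the Y_i become those of the Pellikaan form after
   Y_1 and Y_2 are exchanged. *)
pose A := diag_mx t *m row_perm (tperm i1 i2) U.
pose Y i : {mpoly K[3]} := \sum_j U i j *: 'X_j.
have AE i : \sum_j A i j *: 'X_j = t 0 i *: Y (tperm i1 i2 i).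
  rewrite scaler_sumr; apply: eq_bigr => j _.
  by rewrite /A mul_diag_mx !mxE scalerA.
have Z0 : \sum_j A i0 j *: 'X_j = Y i0.
  by rewrite AE tpermD // mxE (tnth_nth 0) /= scale1r.
have Z1 : \sum_j A i1 j *: 'X_j = t1 *: Y i2.
  by rewrite AE tpermL mxE (tnth_nth 0).
have Z2 : \sum_j A i2 j *: 'X_j = t2 *: Y i1.
  by rewrite AE tpermR mxE (tnth_nth 0).
move=> form_eq; exists A, (s * \det U); split.
- rewrite unitmx_mul row_permE unitmx_mul unitmx_perm U_unit unitmxE det_diag.
  rewrite big_ord3 !mxE !(tnth_nth 0) /= unitfE !mulf_neq0 ?oner_neq0 //.
- by rewrite mulf_neq0 // -unitfE -unitmxE.
rewrite linear_subst_pellikaan Z0 Z1 Z2 -scalerA form_eq.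
rewrite !exprZn -!scalerAl -!scalerAr !scalerA e1 e2 e0 !scalerDr !scalerA.
by [].
Qed.
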